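(* Consider an inventory system as in the context, and suppose in addition that $G$ is twice differentiable on $(0,\infty)$ with $G''(y)\le L$ for all $y>0$. Let $M=\frac{\Delta+\sum_{k=0}^{N-1}\mu_k}{N}$, let $u=\mathrm{LS}(\mu_0+\Delta,\mu_1,\dots,\mu_{N-1})$ and $S_u=\sum_{k=0}^{N-1}(u_k-M)^2$. Then the heuristic policy $\pi^{\mathrm h}$ is admissible and $$J_{\pi^{\mathrm h}}(0)-J^*(0)\ \le\ \frac{L}{2}\Big(S_u+\sum_{k=0}^{N-2}\sigma_k^2\Big).$$
   Context: Inventory system: $N\ge1$; $G:\mathbb{R}_{\ge0}\to\mathbb{R}_{\ge0}$ is strictly convex and increasing with $G(0)=0$. Demands $w_0,\dots,w_{N-1}$ are independent random variables; $w_k$ has mean $\mu_k$, variance $\sigma_k^2$, and support exactly $[\mu_k-\Delta,\mu_k+\Delta]$, where $\Delta\ge0$ and $\mu_k-\Delta>0$ for all $k$. A (Markov) policy is a sequence $\pi=(\pi_0,\dots,\pi_{N-1})$ of measurable maps $\pi_k:\mathbb{R}_{\ge0}\to\mathbb{R}_{\ge0}$; the state evolves by $x_0=0$, $x_{k+1}=x_k+\pi_k(x_k)-w_k$. A policy is admissible if $x_k\ge0$ almost surely for all $k\in\{1,\dots,N\}$. Its expected cost is $J_\pi(0)=\sum_{k=0}^{N-1}\mathbb{E}[G(\pi_k(x_k))]$, and $J^*(0)$ is the infimum of $J_\pi(0)$ over admissible policies. Block-averaging procedure $\mathrm{LS}$: given a finite sequence $v=(v_0,\dots,v_{N-1})$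 of positive reals, define indices $0=k_0<k_1<\dots<k_n=N$ recursively: if $k_l<N$, let $k_{l+1}=k_l+j^*$, where $j^*$ is the largest element of $\arg\max_{j\in\{1,\dots,N-k_l\}}\frac{1}{j}\sum_{i=k_l}^{k_l+j-1}v_i$; stop when $k_n=N$. Then $\mathrm{LS}(v)=(u_0,\dots,u_{N-1})$ with $u_i=\frac{1}{k_{l+1}-k_l}\sum_{m=k_l}^{k_{l+1}-1}v_m$ for $k_l\le i<k_{l+1}$. Heuristic policy: with $u=\mathrm{LS}(\mu_0+\Delta,\mu_1,\dots,\mu_{N-1})$, define target levels $x'_k=\sum_{j=0}^{k}u_j-\sum_{j=0}^{k-1}\mu_j$ for $k=0,\dots,N-1$, and set $\pi^{\mathrm h}_k(x)=\max\{0,x'_k-x\}$. *)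

(* Defs.v *)
From HB Require Import structures.
From mathcomp Require Import all_boot all_order all_algebra.
From mathcomp Require Import all_classical all_reals all_analysis.
Set Implicit Arguments. Unset Strict Implicit. Unset Printing Implicit Defensive.
Import Order.TTheory GRing.Theory Num.Theory.
Import numFieldNormedType.Exports.
Local Open Scope classical_set_scope.
Local Open Scope ring_scope.

Section Inventory.
Context {R : realType} {d : measure_display} {T : measurableType d}.

(* Mutual independence of the real random variables w_0, ..., w_{N-1}:
   product rule for the joint events {w_i in B_i}, B_i Borel
   (sub-families are obtained with B_i = setT). *)
Definition mutually_independent (P : probability T R) (w : nat -> T -> R)
    (N : nat) : Prop :=
  (forall i, (i < N)%N -> measurable_fun setT (w i)) /\
  forall B : nat -> set R, (forall i, measurable (B i)) ->
    P (\bigcap_(i in [set i | (i < N)%N]) (w i @^-1` B i)) =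
    (\prod_(i < N) P (w i @^-1` B i))%E.

Definition rv_support (P : probability T R) (X : T -> R) : set R :=
  [set x | forall e : R, 0 < e -> (0 < P (X @^-1` ball x e))%E].

Fixpoint state (pi : nat -> R -> R) (w : nat -> T -> R) (k : nat) (t : T)
  : R :=
  if k is k'.+1 then
    let x := state pi w k' t in x + pi k' x - w k' t
  else 0.

Definition is_policy (pi : nat -> R -> R) : Prop :=
  forall k, measurable_fun setT (pi k) /\ forall x, 0 <= pi k x.

Definition admissible (P : probability T R) (w : nat -> T -> R) (N : nat)
    (pi : nat -> R -> R) : Prop :=
  forall k, (1 <= k <= N)%N -> \forall t \ae P, 0 <= state pi w k t.

Definition cost (P : probability T R) (w : nat -> T -> R) (N : nat)
    (G : R -> R) (pi : nat -> R -> R) : \bar R :=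
  (\sum_(k < N) \int[P]_t (G (pi k (state pi w k t)))%:E)%E.

Definition opt_cost (P : probability T R) (w : nat -> T -> R) (N : nat)
    (G : R -> R) : \bar R :=
  ereal_inf [set cost P w N G pi | pi in
               [set pi | is_policy pi /\ admissible P w N pi]].

End Inventory.

Section LS.
Context {R : realType}.

Definition avg (v : nat -> R) (k j : nat) : R :=
  (\sum_(k <= i < k + j) v i) / j%:R.

(* largest element of argmax_{j in {1..m}} avg v k j  (m >= 1) *)
Fixpoint best_len (v : nat -> R) (k m : nat) : nat :=
  if m is m'.+1 then
    (if m' is 0 then 1%N
     else let j := best_len v k m' in
          if avg v k j <= avg v k m then m else j)
  else 1%N.

(* blocks starting at k_l = k; fuel bounds the number of remaining blocks *)
Fixpoint ls_aux (v : nat -> R) (N k fuel : nat) (i : nat) : R :=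
  if fuel is fuel'.+1 then
    let j := best_len v k (N - k) in
    if (i < k + j)%N then avg v k j else ls_aux v N (k + j) fuel' i
  else 0.

(* LS(v_0, ..., v_{N-1}) as a sequence indexed by nat (meaningful for i < N) *)
Definition LS (v : nat -> R) (N : nat) : nat -> R := ls_aux v N 0 N.

Definition heur_u (mu : nat -> R) (Delta : R) (N : nat) : nat -> R :=
  LS (fun i => if i == 0%N then mu 0%N + Delta else mu i) N.

Definition target (mu : nat -> R) (Delta : R) (N k : nat) : R :=
  \sum_(0 <= j < k.+1) heur_u mu Delta N j - \sum_(0 <= j < k) mu j.

Definition heur_policy (mu : nat -> R) (Delta : R) (N : nat)
  : nat -> R -> R :=
  fun k x => Num.max 0 (target mu Delta N k - x).

End LS.

(* Main.v *)
(* An admissible policy costs at least [N * G M]: the post-order level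
   [x_(N-1) + pi_(N-1) x_(N-1)] dominates [w_(N-1)] almost surely and is
   independent of it, hence it dominates the upper end [mu_(N-1) + Delta] of the
   support; so the orders sum to at least
   [w_0 + ... + w_(N-2) + mu_(N-1) + Delta], and the tangent of [G] at [M]
   finishes by convexity.  Under the heuristic policy the stock never exceeds
   the next target, so the order at stage [k] is
   [u_k + (w_(k-1) - mu_(k-1))], whose mean is [u_k]; the second-order bound
   [G y <= G M + G' M (y - M) + L / 2 (y - M)^2] and [sum u_k = N M] give the
   upper bound.  Admissibility holds because the prefix sums of [LS v]
   dominate those of [v]. *)
Require Import Defs.
From HB Require Import structures.
From mathcomp Require Import all_boot all_order all_algebra.
From mathcomp Require Import all_classical all_reals all_analysis.
From mathcomp Require Import measurable_realfun zify ring lra.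
Import Order.TTheory GRing.Theory Num.Theory.
Import numFieldNormedType.Exports.
Local Open Scope classical_set_scope.
Local Open Scope ring_scope.

(** * Block averaging: prefix sums, total and lower bounds of [LS] *)

Section BlockAveraging.
Context {R : realType}.
Implicit Types (v : nat -> R) (k m n j : nat).

Lemma best_len_gt0 v k m : (0 < best_len v k m)%N.
Proof. by elim: m => [|[|m] IH] //=; case: ifP. Qed.

Lemma best_len_le v k m : (0 < m)%N -> (best_len v k m <= m)%N.
Proof.
elim: m => [|[|m] IH] // _; rewrite [best_len _ _ _]/=.
by case: ifP => // _; apply: leq_trans (IH _) _.
Qed.

Lemma avg_best_len v k m j : (0 < j <= m)%N ->
  avg v k j <= avg v k (best_len v k m).
Proof.
elim: m j => [|[|m] IH] j; first by case: j.
  by move=> jm; have -> : j = 1%N by lia.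
move=> /andP[j0]; rewrite leq_eqVlt => /orP[/eqP ->|jm];
  rewrite [best_len _ _ _]/=; case: ifP => [|/negbT].
- by [].
- by rewrite -ltNge => /ltW.
- by apply: le_trans; apply: IH; rewrite j0.
- by move=> _; apply: IH; rewrite j0.
Qed.

Lemma avgM v k j : (0 < j)%N ->
  \sum_(k <= i < k + j) v i = avg v k j * j%:R.
Proof. by move=> j0; rewrite /avg divfK // pnatr_eq0 -lt0n. Qed.

Lemma avg_gt v k j c : (0 < j)%N ->
  (forall i, (k <= i < k + j)%N -> c < v i) -> c < avg v k j.
Proof.
move=> j0 cv; rewrite /avg ltr_pdivlMr ?ltr0n //.
have -> : c * j%:R = \sum_(k <= i < k + j) c.
  by rewrite sumr_const_nat addKn mulr_natr.
by apply: ltr_sum_nat => //; rewrite -{1}[k]addn0 ltn_add2l.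
Qed.

Lemma sum_ls_aux_block v N k fuel n :
  (n <= best_len v k (N - k))%N ->
  \sum_(k <= i < k + n) ls_aux v N k fuel.+1 i =
  avg v k (best_len v k (N - k)) * n%:R.
Proof.
move=> nj.
rewrite (@eq_big_nat _ _ _ _ _ _ (fun=> avg v k (best_len v k (N - k)))).
  by rewrite sumr_const_nat addKn mulr_natr.
by move=> i /andP[_ ikn] /=; rewrite (leq_trans ikn) // leq_add2l.
Qed.

Lemma sum_ls_aux_tail v N k fuel n :
  \sum_(k + best_len v k (N - k) <= i < n) ls_aux v N k fuel.+1 i =
  \sum_(k + best_len v k (N - k) <= i < n)
    ls_aux v N (k + best_len v k (N - k)) fuel i.
Proof. by apply: eq_big_nat => i /andP[jki _] /=; rewrite ltnNge jki. Qed.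

(** Inside the first block, a prefix of [v] has average at most that of the block, because the block
    length maximizes the averages. A complete block keeps its sum, so the claim passes to the next
    block start. Blocks have length at least one, hence fuel [N - k] is enough. *)
Lemma ls_aux_prefix_ge v N fuel k n : (k <= n <= N)%N -> (N - k <= fuel)%N ->
  \sum_(k <= i < n) v i <= \sum_(k <= i < n) ls_aux v N k fuel i.
Proof.
elim: fuel k => [|fuel IH] k kn Nk; first by rewrite !big_geq //; lia.
have [kN|Nk'] := ltnP k N; last by rewrite !big_geq //; lia.
have j0 := best_len_gt0 v k (N - k).
have jN : (best_len v k (N - k) <= N - k)%N by rewrite best_len_le // subn_gt0.
have [nj|jn] := leqP n (k + best_len v k (N - k)).
  have -> : n = (k + (n - k))%N by lia.
  rewrite sum_ls_aux_block; last by lia.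
  have [->|nk] := eqVneq (n - k)%N 0%N.
    by rewrite big_geq ?mulr0 // addn0.
  rewrite avgM ?lt0n //; apply: ler_wpM2r => //; apply: avg_best_len; lia.
rewrite (@big_cat_nat _ _ _ (k + best_len v k (N - k))) /=; [|lia|lia].
rewrite [leRHS](@big_cat_nat _ _ _ (k + best_len v k (N - k))) /=; [|lia|lia].
rewrite sum_ls_aux_block // sum_ls_aux_tail avgM // lerD2l; apply: IH; lia.
Qed.

Lemma ls_aux_total v N fuel k : (k <= N)%N -> (N - k <= fuel)%N ->
  \sum_(k <= i < N) ls_aux v N k fuel i = \sum_(k <= i < N) v i.
Proof.
elim: fuel k => [|fuel IH] k kN Nk; first by rewrite !big_geq //; lia.
move: kN; rewrite leq_eqVlt => /orP[/eqP->|kN]; first by rewrite !big_geq.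
have j0 := best_len_gt0 v k (N - k).
have jN : (best_len v k (N - k) <= N - k)%N by rewrite best_len_le // subn_gt0.
rewrite (@big_cat_nat _ _ _ (k + best_len v k (N - k))) /=; [|lia|lia].
rewrite [RHS](@big_cat_nat _ _ _ (k + best_len v k (N - k))) /=; [|lia|lia].
by rewrite sum_ls_aux_block // sum_ls_aux_tail -avgM // IH //; lia.
Qed.

Lemma ls_aux_gt v N c fuel k i : (forall i, (i < N)%N -> c < v i) ->
  (k <= i < N)%N -> (N - k <= fuel)%N -> c < ls_aux v N k fuel i.
Proof.
move=> cv; elim: fuel k => [|fuel IH] k kiN Nk /=; first by lia.
have j0 := best_len_gt0 v k (N - k).
have jN : (best_len v k (N - k) <= N - k)%N by rewrite best_len_le //; lia.
case: ifP => ij; last by apply: IH; lia.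
by apply: avg_gt => // i' ?; apply: cv; lia.
Qed.

Lemma LS_prefix_ge v N n : (n <= N)%N ->
  \sum_(0 <= i < n) v i <= \sum_(0 <= i < n) LS v N i.
Proof. by move=> nN; apply: ls_aux_prefix_ge; rewrite ?subn0. Qed.

Lemma LS_total v N : \sum_(0 <= i < N) LS v N i = \sum_(0 <= i < N) v i.
Proof. by apply: ls_aux_total; rewrite ?subn0. Qed.

Lemma LS_gt v N c i : (forall i, (i < N)%N -> c < v i) -> (i < N)%N ->
  c < LS v N i.
Proof. by move=> cv iN; apply: ls_aux_gt; rewrite ?subn0. Qed.

End BlockAveraging.

(** * Quadratic upper bound and tangent lower bound for the cost function *)

Section Calculus.
Context {R : realType}.
Implicit Types (f G : R -> R).

Lemma MVT_pos {f : R -> R} {a b : R} : 0 < a -> a < b ->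
  (forall y, 0 < y -> derivable f y 1) ->
  exists2 c, a < c < b & f b - f a = derive1 f c * (b - a).
Proof.
move=> a0 ab df.
have [||c] := @MVT R f (derive1 f) a b ab; last by rewrite in_itv /=; exists c.
  move=> x; rewrite in_itv /= => /andP[ax _]; rewrite derive1E.
  by apply/derivableP/df/(lt_trans a0).
apply: derivable_within_continuous => x; rewrite in_itv /= => /andP[ax _].
exact/df/(lt_le_trans a0).
Qed.

(** Up to a constant, [h] is the difference of [G] and the quadratic. Its derivative G'(z) - G'(m) -
    L (z - m) is nonnegative left of [m] and nonpositive right of it, since G'' is at most [L]; so
    [h] is largest at [m]. *)
Lemma taylor2_le G L (m y : R) :
  (forall y, 0 < y -> derivable G y 1 /\ derivable (derive1 G) y 1) ->
  (forall y, 0 < y -> derive1 (derive1 G) y <= L) -> 0 < m -> 0 < y ->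
  G y <= G m + derive1 G m * (y - m) + L / 2 * (y - m) ^+ 2.
Proof.
move=> dG G2 m0 y0.
have dG1 (z : R) (z0 : 0 < z) : derivable G z 1 by have [] := dG z z0.
have dG2 (z : R) (z0 : 0 < z) : derivable (derive1 G) z 1 by have [] := dG z z0.
pose h z := G z - (derive1 G m * z + L / 2 * (z - m) ^+ 2).
have h_is (z : R) : 0 < z ->
    is_derive z 1 h (derive1 G z - (derive1 G m + L * (z - m))).
  move=> z0; rewrite derive1E.
  have dGz := derivableP (dG1 _ z0).
  apply: is_derive_eq; rewrite /GRing.scale /=; by field.
have dh (s : R) (s0 : 0 < s) : derivable h s 1.
  exact: (@ex_derive _ _ _ _ _ _ _ (h_is s s0)).
have h1 (z : R) : 0 < z ->
    derive1 h z = derive1 G z - (derive1 G m + L * (z - m)).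
  move=> z0; rewrite derive1E.
  exact: (@derive_val _ _ _ _ _ _ _ (h_is z z0)).
suff : h y <= h m by rewrite /h; lra.
have [ym|my|->//] := ltgtP y m.
(* The point [c] comes from the mean value theorem for [h]; a second use for G' between [c] and [m]
   gives [e] and the sign of h'(c). *)
- have [c /andP[yc cm] hE] := MVT_pos y0 ym dh.
  have [e /andP[ce em] gE] := MVT_pos (lt_trans y0 yc) cm dG2.
  have c0 := lt_trans y0 yc; have e0 := lt_trans c0 ce.
  rewrite h1 // in hE.
  rewrite -subr_ge0 hE; apply: mulr_ge0; last by rewrite subr_ge0 ltW.
  have := mulr_ge0 (_ : 0 <= L - derive1 (derive1 G) e) (_ : 0 <= m - c).
  rewrite !subr_ge0 => /(_ (G2 _ e0) (ltW cm)); lra.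
- have [c /andP[mc cy] hE] := MVT_pos m0 my dh.
  have [e /andP[me ec] gE] := MVT_pos m0 mc dG2.
  have e0 := lt_trans m0 me; have c0 := lt_trans e0 ec.
  rewrite h1 // in hE.
  rewrite -subr_le0 hE; apply: mulr_le0_ge0; last by rewrite subr_ge0 ltW.
  have := mulr_ge0 (_ : 0 <= L - derive1 (derive1 G) e) (_ : 0 <= c - m).
  rewrite !subr_ge0 => /(_ (G2 _ e0) (ltW mc)); lra.
Qed.

(** Convexity bounds the difference quotient at [m] along [y - m] by [G y - G m] for every step [h]
    in (0, 1); the bound survives the limit. *)
Lemma convex_tangent_le G (m y : R) :
  (forall x y t, 0 <= x -> 0 <= y -> x != y -> 0 < t < 1 ->
     G (t * x + (1 - t) * y) < t * G x + (1 - t) * G y) ->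
  derivable G m 1 -> 0 <= m -> 0 <= y ->
  G m + derive1 G m * (y - m) <= G y.
Proof.
move=> cG dG m0 y0; have [->|ym] := eqVneq y m; first by lra.
have dGv : derivable G m (y - m).
  by apply: diff_derivable; apply/derivable1_diffP.
have DE : 'D_(y - m) G m = derive1 G m * (y - m).
  rewrite derive1E !deriveE; [|exact/derivable1_diffP..].
  by rewrite -{1}[y - m]mulr1 linearZ /= mulrC.
suff : 'D_(y - m) G m <= G y - G m by rewrite DE; lra.
(* Only steps [h > 0] make the point a convex combination of [y] and [m], so the derivative is read
   as a right-hand limit. *)
have lim := cvg_dnbhs_at_right dGv.
rewrite /derive -(cvg_lim _ lim) //.
apply: limr_le; first by apply/cvg_ex; exists ('D_(y - m) G m).
near=> h.
have h0 : 0 < h by [].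
have h1 : h < 1 by near: h; exact: nbhs_right_lt.
have := cG y m h y0 m0 ym; rewrite h0 h1 => /(_ isT) cvx.
rewrite /= /GRing.scale /= ler_pdivrMl //.
have -> : h * (y - m) + m = h * y + (1 - h) * m by ring.
lra.
Unshelve. all: by end_near.
Qed.

End Calculus.

(** * Supports, almost-sure comparison of integrals, and independence *)

Section Probability.
Context {R : realType} {d : measure_display} {T : measurableType d}.
Variable P : probability T R.
Implicit Types (X Y f g : T -> R) (pi : nat -> R -> R).

(* Rational balls that are [P]-null cover the complement of the support. *)
Lemma rv_support_ae X : measurable_fun setT X ->
  \forall t \ae P, rv_support P X (X t).
Proof.
move=> mX.
(* The pairs of a rational centre and a radius [k.+1%:R^-1] are enumerated by their codes; a number
   that codes no pair gets the empty set. *)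
pose N0 n : set R := if (unpickle n : option (rat * nat)) is Some (q, k) then
  ball (ratr q : R) k.+1%:R^-1 else set0.
pose F n := if P (X @^-1` N0 n) == 0%E then X @^-1` N0 n else set0.
have mN0 n : measurable (X @^-1` N0 n).
  rewrite -[_ @^-1` _]setTI; apply: mX => //.
  rewrite /N0; case: unpickle => [[q k]|]; [exact: measurable_ball|].
  exact: measurable0.
apply: (@negligibleS _ _ _ P (\bigcup_n F n)); last first.
  apply: negligible_bigcup => n; rewrite /F; case: ifPn => [/eqP PN0|_].
    by apply/negligibleP.
  exact: negligible_set0.
move=> t /= /existsNP[e] /not_implyP[e0] /negP; rewrite -leNgt => Pe.
(* With radius below [e / 2], a rational ball containing [X t] lies in the null ball of radius [e]
   around [X t]. *)
have [k ke] : exists k : nat, k.+1%:R^-1 < e / 2.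
  have := @cvg_harmonic R => /cvgrPdist_lt /(_ (e / 2)) [|k _ /(_ k (leqnn k))].
    by rewrite divr_gt0.
  by rewrite /= sub0r normrN ger0_norm ?harmonic_ge0 // => ?; exists k.
have k0 : 0 < k.+1%:R^-1 :> R by rewrite invr_gt0.
have [|q] := @rat_in_itvoo R (X t - k.+1%:R^-1) (X t + k.+1%:R^-1).
  by rewrite ltrBlDr -addrA ltrDl addr_gt0.
rewrite in_itv /= => /andP[q1 q2].
have [n nE] : exists n, (unpickle n : option (rat * nat)) = Some (q, k).
  by exists (pickle (q, k)); rewrite pickleK.
have N0E : N0 n = ball (ratr q : R) k.+1%:R^-1 by rewrite /N0 nE.
exists n; first exact: I.
rewrite /F ifT /= ?N0E; first by rewrite -ball_normE /= ltr_distl q1 q2.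
rewrite eq_le measure_ge0 andbT; apply: le_trans Pe; apply: le_measure.
- by rewrite -N0E inE.
- by rewrite inE -[_ @^-1` _]setTI; apply: mX => //; exact: measurable_ball.
- move=> s /=; rewrite -!ball_normE /= !ltr_distl.
  move: (k.+1%:R^-1) (ratr q) k0 ke q1 q2 => a r a0 ae r1 r2 /andP[s1 s2].
  by apply/andP; split; lra.
Qed.

(** On a null set [g] may be negative; replacing it by [max g 0] leaves its integral unchanged and
    makes monotonicity for nonnegative functions applicable. *)
Lemma ge0_le_integral_ae f g : measurable_fun setT f ->
  P.-integrable setT (EFin \o g) -> (forall t, 0 <= f t) ->
  (\forall t \ae P, f t <= g t) ->
  (\int[P]_t (f t)%:E <= \int[P]_t (g t)%:E)%E.
Proof.
move=> mf /integrableP[/measurable_EFinP mg _] f0 fg.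
pose h t := Num.max (g t) 0.
have mh : measurable_fun setT h by exact: measurable_maxr.
rewrite [leRHS](_ : _ = \int[P]_t (h t)%:E)%E.
  apply: ae_ge0_le_integral => //=; try exact/measurable_EFinP.
  - by move=> t _; rewrite lee_fin.
  - by move=> t _; rewrite lee_fin le_max lexx orbT.
  - by apply: filterS fg => t fgt _; rewrite lee_fin le_max fgt.
apply: ae_eq_integral => //; try exact/measurable_EFinP.
by apply: filterS fg => t fgt _; rewrite /h max_l // (le_trans _ fgt).
Qed.

(** The integral of [f] may be infinite, as can the cost of an arbitrary policy. The positive part
    of [g] is inserted between the two integrals. *)
Lemma le_integral_ae_ge0 f g : measurable_fun setT f ->
  P.-integrable setT (EFin \o g) -> (forall t, 0 <= f t) ->
  (\forall t \ae P, g t <= f t) ->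
  (\int[P]_t (g t)%:E <= \int[P]_t (f t)%:E)%E.
Proof.
move=> mf ig f0 gf; have /integrableP[/measurable_EFinP mg _] := ig.
pose h t := Num.max (g t) 0.
have mh : measurable_fun setT h by exact: measurable_maxr.
apply: (@le_trans _ _ (\int[P]_t (h t)%:E)%E).
  rewrite integralE (_ : (fun t => (h t)%:E) = (EFin \o g)^\+)%E.
    by rewrite -[leRHS]sube0; apply: leeB => //; apply: integral_ge0.
  by apply/funext => t; rewrite funeposE /= -EFin_max.
apply: ae_ge0_le_integral => //=; try exact/measurable_EFinP.
- by move=> t _; rewrite lee_fin le_max lexx orbT.
- by move=> t _; rewrite lee_fin.
- by apply: filterS gf => t gft _; rewrite lee_fin ge_max gft f0.
Qed.

Lemma integrable_expectation_fin f (r : R) : measurable_fun setT f ->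
  (\int[P]_t (f t)%:E = r%:E)%E -> P.-integrable setT (EFin \o f).
Proof.
move=> mf fr; apply/integrableP; split; first exact/measurable_EFinP.
by rewrite integral_fin_num_abs // fr.
Qed.

(** Since [c] is in the support, [X] is within 1/(n+1) of [c] with positive probability. By
    independence, [Y < c - 1/(n+1)] with positive probability would then force [Y < X] with positive
    probability. *)
Lemma ae_ge_of_independent X Y (c : R) :
  measurable_fun setT X -> measurable_fun setT Y ->
  (forall A B, measurable A -> measurable B ->
     P (Y @^-1` A `&` X @^-1` B) = (P (Y @^-1` A) * P (X @^-1` B))%E) ->
  rv_support P X c -> (\forall t \ae P, X t <= Y t) ->
  \forall t \ae P, c <= Y t.
Proof.
move=> mX mY indep cX XY.
pose F n := Y @^-1` `]-oo, c - n.+1%:R^-1[.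
apply: (@negligibleS _ _ _ P (\bigcup_n F n)).
  move=> t /= /negP; rewrite -ltNge => Yc.
  have := @cvg_harmonic R => /cvgrPdist_lt /(_ (c - Y t)).
  case=> [|k _ /(_ k (leqnn k))].
    by rewrite subr_gt0.
  rewrite /= sub0r normrN ger0_norm ?harmonic_ge0 // => kY; exists k => //.
  by rewrite /F /= in_itv /= ltrBrDr -ltrBrDl.
apply: negligible_bigcup => n.
have mF : measurable (F n) by rewrite -[F n]setTI; apply: mY.
apply/negligibleP => //.
have n0 : 0 < n.+1%:R^-1 :> R by rewrite invr_gt0.
have mB : measurable (X @^-1` ball c n.+1%:R^-1).
  by rewrite -[_ @^-1` _]setTI; apply: mX => //; exact: measurable_ball.
have : P (F n `&` X @^-1` ball c n.+1%:R^-1) = 0%E.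
  apply/negligibleP; first exact: measurableI.
  apply: negligibleS XY => t /= [Ft Xt]; apply/negP; rewrite -ltNge.
  move: Ft Xt; rewrite /F /= in_itv -ball_normE /= ltr_distl => Ft /andP[_].
  by rewrite -ltrBlDr; apply: lt_trans.
rewrite indep //; last exact: measurable_ball.
move/eqP; rewrite mule_eq0 => /orP[/eqP //|/eqP P0].
by have := cX _ n0; rewrite P0 ltxx.
Qed.

End Probability.

(** * Measurability of the states; independence of a demand from the earlier ones *)

Section Inventory.
Context {R : realType}.
Implicit Types (pi : nat -> R -> R).

(** The measurable structure on [T] is a parameter here, because the lemma serves both the ambient
    sigma-algebra and the one generated by past demands. *)
Lemma measurable_state {d : measure_display} {T : measurableType d}
    pi (w : nat -> T -> R) k :
  (forall i, measurable_fun setT (pi i)) ->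
  (forall i, (i < k)%N -> measurable_fun setT (w i)) ->
  measurable_fun setT (state pi w k).
Proof.
move=> mpi; elim: k => [|k IH] mw /=; first exact: measurable_cst.
have ms : measurable_fun setT (state pi w k) by apply: IH => i /ltnW; exact: mw.
apply: measurable_funB; last exact: mw.
by apply: measurable_funD => //; apply: measurableT_comp.
Qed.

Context {d : measure_display} {T : measurableType d}.
Variable P : probability T R.
Implicit Type w : nat -> T -> R.

(** A pi-system generating the sigma-algebra of the demands before stage [n]. *)
Definition cylinders w (n : nat) : set (set T) :=
  [set A | exists2 B : nat -> set R, (forall i, measurable (B i)) &
     A = \bigcap_(i in [set i | (i < n)%N]) (w i @^-1` B i)].

(* Both sides are finite measures in [A] that agree on a pi-system. *)
Lemma cylinders_independent w n A B :
  mutually_independent P w n.+1 -> <<s cylinders w n >> A -> measurable B ->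
  P (A `&` w n @^-1` B) = (P A * P (w n @^-1` B))%E.
Proof.
move=> [mw indep] sA mB.
have mwB i C : (i <= n)%N -> measurable C -> measurable (w i @^-1` C).
  by move=> ni mC; rewrite -[_ @^-1` _]setTI; apply: mw.
have mC : cylinders w n `<=` measurable.
  move=> _ [C mC ->]; apply: bigcap_measurableType => i /= /ltnW ni.
  exact: mwB.
have CT : cylinders w n setT.
  exists (fun=> setT) => //.
  by rewrite bigcapT // => i _; rewrite preimage_setT.
have mD := mwB n B (leqnn n) mB.
have PDf : P (w n @^-1` B) \is a fin_num by exact: fin_num_measure.
pose r : {nonneg R} := NngNum (fine_ge0 (measure_ge0 P (w n @^-1` B))).
have := @g_sigma_algebra_measure_unique _ _ _ (cylinders w n) mC (fun=> setT)
  (fun=> CT) _ (mrestr P mD) (mscale r P) _ _ _ A sA.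
rewrite /= /mrestr /mscale /= fineK // muleC; apply.
- by rewrite bigcup_const //; exists 0%N.
- move=> _ _ [C1 mC1 ->] [C2 mC2 ->]; exists (fun i => C1 i `&` C2 i).
    by move=> i; exact: measurableI.
  by rewrite -bigcapI; apply: eq_bigcapr => i _; rewrite preimage_setI.
- move=> _ [C mC0 ->].
  have lt1 : [set i | (i < n.+1)%N] = [set i | (i < n)%N] `|` [set n].
    apply/seteqP; split=> i /=; last by case=> [/leqW|->].
    by rewrite ltnS leq_eqVlt => /orP[/eqP|]; [right|left].
  have bigE D : \bigcap_(i in [set i | (i < n.+1)%N])
      (w i @^-1` (if i == n then D else C i)) =
      \bigcap_(i in [set i | (i < n)%N]) (w i @^-1` C i) `&` w n @^-1` D.
    rewrite lt1 bigcap_setU bigcap_set1 eqxx; congr (_ `&` _).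
    by apply: eq_bigcapr => i /= ni; rewrite ltn_eqF.
  have prodE (D : set R) : (\prod_(i < n)
      P (w i @^-1` (if (i : nat) == n then D else C i)) =
      \prod_(i < n) P (w i @^-1` C i))%E.
    by apply: eq_bigr => i _; rewrite ltn_eqF.
  have mC' D : measurable D -> forall i, measurable (if i == n then D else C i).
    by move=> mD' i; case: ifP.
  (* The product rule is used twice, with [B] and with [setT] in position [n]; the second use
     identifies the product over [i < n] with the probability of the cylinder. *)
  have := indep _ (mC' B mB); rewrite bigE big_ord_recr /= eqxx prodE => ->.
  have := indep _ (mC' setT measurableT).
  rewrite bigE big_ord_recr /= eqxx prodE.
  by rewrite preimage_setT setIT probability_setT mule1 muleC => <-.
- by move=> _; rewrite setTI ltey_eq PDf.
Qed.

End Inventory.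

(** * Properties of the averaged levels [u] of the heuristic *)

Section HeuristicPath.
Context {R : realType} {T : Type}.
Variables (mu : nat -> R) (Delta : R) (N : nat).
Hypothesis Delta_ge0 : 0 <= Delta.
Hypothesis mu_gt : forall k, (k < N)%N -> Delta < mu k.

Local Notation u := (heur_u mu Delta N).

(** A demand falls below its mean by at most [Delta], so this margin keeps every heuristic order
    positive. *)
Lemma heur_u_gt k : (k < N)%N -> Delta < u k.
Proof.
move=> kN; apply: LS_gt => // i iN; case: eqP => [i0|_]; last exact: mu_gt.
by apply: (lt_le_trans (mu_gt 0 _)); [rewrite -i0|rewrite lerDl].
Qed.

Lemma sum_shifted_demand n : (0 < n)%N ->
  \sum_(0 <= i < n) (if i == 0%N then mu 0%N + Delta else mu i) =
  Delta + \sum_(0 <= i < n) mu i.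
Proof. by case: n => // n _; rewrite !big_nat_recl //=; ring. Qed.

Lemma heur_u_prefix n : (0 < n <= N)%N ->
  Delta + \sum_(0 <= i < n) mu i <= \sum_(0 <= i < n) u i.
Proof. by move=> /andP[n0 nN]; rewrite -sum_shifted_demand // LS_prefix_ge. Qed.

Lemma heur_u_total : (0 < N)%N ->
  \sum_(0 <= i < N) u i = Delta + \sum_(0 <= i < N) mu i.
Proof. by move=> N0; rewrite -sum_shifted_demand // LS_total. Qed.

(** The index is shifted: the order at stage [k] compensates the fluctuation of the demand of stage
    [k - 1], and stage 0 has nothing to compensate. *)
Definition noise (w : nat -> T -> R) k t : R :=
  if k is k'.+1 then w k' t - mu k' else 0.

End HeuristicPath.

(** * The heuristic along one path whose demands lie in their intervals *)

Section HeuristicState.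
Context {R : realType} {d : measure_display} {T : measurableType d}.
Variables (mu : nat -> R) (Delta : R) (N : nat) (w : nat -> T -> R) (t : T).
Hypothesis Delta_ge0 : 0 <= Delta.
Hypothesis mu_gt : forall k, (k < N)%N -> Delta < mu k.
Hypothesis wP : forall k, (k < N)%N -> mu k - Delta <= w k t <= mu k + Delta.

Local Notation u := (heur_u mu Delta N).
Local Notation x := (state (heur_policy mu Delta N) w).

Lemma heur_order_gt0 k : (k < N)%N -> 0 < u k + noise mu w k t.
Proof.
case: k => [|k] kN /=; have := heur_u_gt mu Delta N Delta_ge0 mu_gt _ kN.
  by rewrite addr0; apply: le_lt_trans.
by have /andP[] := wP _ (ltnW kN); lra.
Qed.

Lemma targetS k : target mu Delta N k.+1 = target mu Delta N k + u k.+1 - mu k.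
Proof. by rewrite /target !big_nat_recr //=; ring. Qed.

Lemma heur_policy_below k y : 0 <= target mu Delta N k - y ->
  heur_policy mu Delta N k y = target mu Delta N k - y.
Proof. by move=> y_le; rewrite /heur_policy max_r. Qed.

(** A positive gap to the target is filled exactly by the order, so after the demand the next gap is
    [u k.+1] plus the deviation of [w k] from its mean. *)
Lemma heur_state k : (k < N)%N ->
  target mu Delta N k - x k t = u k + noise mu w k t.
Proof.
elim: k => [|k IH] kN /=.
  by rewrite /target big_nat1 big_geq //; ring.
have tk := IH (ltnW kN); have := heur_order_gt0 _ (ltnW kN); rewrite -tk => tk0.
rewrite targetS heur_policy_below ?(ltW tk0) //; ring.
Qed.

Lemma heur_order k : (k < N)%N ->
  heur_policy mu Delta N k (x k t) = u k + noise mu w k t.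
Proof.
by move=> kN; rewrite heur_policy_below heur_state // ltW // heur_order_gt0.
Qed.

(** After ordering, the stock equals the target. By the prefix inequality for [u], the target is at
    least [mu k + Delta], the largest possible demand. *)
Lemma heur_state_ge0 k : (k <= N)%N -> 0 <= x k t.
Proof.
case: k => [|k] kN //=; rewrite heur_order // -heur_state //.
have := heur_u_prefix mu Delta N k.+1 kN; rewrite /target.
by rewrite (big_nat_recr k) //=; have /andP[] := wP _ kN; lra.
Qed.

End HeuristicState.

(** * Expectations of quadratic functions of the noise *)

Section Moments.
Context {R : realType} {d : measure_display} {T : measurableType d}.
Variable P : probability T R.

(** Serves both cost bounds: with [c = L / 2] for the upper one and [c = 0] for the lower one. *)
Lemma expectation_quadratic (Z : T -> R) (a b c s : R) :
  measurable_fun setT Z -> (\int[P]_t (Z t)%:E = 0)%E ->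
  (\int[P]_t (Z t ^+ 2)%:E = s%:E)%E ->
  P.-integrable setT (EFin \o (fun t => a + b * Z t + c * Z t ^+ 2)) /\
  (\int[P]_t (a + b * Z t + c * Z t ^+ 2)%:E = (a + c * s)%:E)%E.
Proof.
move=> mZ Z1 Z2.
have i1 := integrable_expectation_fin P Z _ mZ Z1.
have mZ2 : measurable_fun setT (fun t => Z t ^+ 2) by exact: measurable_funX.
have i2 := integrable_expectation_fin P _ _ mZ2 Z2.
have i0 : P.-integrable setT (EFin \o cst a).
  exact: finite_measure_integrable_cst.
have ib := integrableZl measurableT b i1.
have ic := integrableZl measurableT c i2.
have i01 := integrableD measurableT i0 ib.
split; first exact: (integrableD measurableT i01 ic).
transitivity (\int[P]_t (((EFin \o cst a) t + b%:E * (EFin \o Z) t)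
   + c%:E * (EFin \o (fun t => Z t ^+ 2)%R) t))%E; first by [].
rewrite integralD // integralD // !integralZl // [X in (_ + _ * X)%E]Z2.
rewrite [X in (_ * X)%E]Z1 (integral_cst P measurableT a%:E).
by rewrite [X in (_ * X + _)%E](probability_setT P) mule1 mule0 adde0.
Qed.

Lemma noise_moments (mu sigma : nat -> R) (w : nat -> T -> R) N k :
  (forall i, (i < N)%N -> measurable_fun setT (w i)) ->
  (forall i, (i < N)%N -> (\int[P]_t (w i t)%:E = (mu i)%:E)%E) ->
  (forall i, (i < N)%N ->
     (\int[P]_t ((w i t - mu i) ^+ 2)%:E = (sigma i ^+ 2)%:E)%E) ->
  (k < N)%N ->
  [/\ measurable_fun setT (noise mu w k),
      (\int[P]_t (noise mu w k t)%:E = 0)%E &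
      (\int[P]_t (noise mu w k t ^+ 2)%:E =
        (if k is k'.+1 then sigma k' ^+ 2 else 0)%:E)%E].
Proof.
move=> mw w1 w2; case: k => [|k] /=.
  split; first exact: measurable_cst.
    by apply: integral0_eq.
  by apply: integral0_eq => t _; rewrite expr0n.
move=> /ltnW kN; split; last exact: w2.
  exact: measurable_funB (mw _ kN) (measurable_cst _).
have iw := integrable_expectation_fin P _ _ (mw _ kN) (w1 _ kN).
have ic : P.-integrable setT (EFin \o cst (mu k)).
  exact: finite_measure_integrable_cst.
transitivity (\int[P]_t ((EFin \o w k) t - (EFin \o cst (mu k)) t))%E => //.
rewrite integralB // [X in (X - _)%E]w1 //.
rewrite (integral_cst P measurableT (mu k)%:E).
by rewrite [X in (_ * X)%E](probability_setT P) mule1 subee.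
Qed.

End Moments.

(** * Upper bound for the heuristic cost, lower bound for every admissible cost *)

Section Bounds.
Context {R : realType} {d : measure_display} {T : measurableType d}.
Variables (P : probability T R) (N : nat) (G : R -> R) (Delta : R).
Variables (mu sigma : nat -> R) (w : nat -> T -> R).
Hypothesis G_ge0 : forall x, 0 <= x -> 0 <= G x.
Hypothesis G_incr : forall x y, 0 <= x -> x < y -> G x < G y.
Hypothesis Delta_ge0 : 0 <= Delta.
Hypothesis mu_gt : forall k, (k < N)%N -> 0 < mu k - Delta.
Hypothesis w_indep : mutually_independent P w N.
Hypothesis w_mean :
  forall k, (k < N)%N -> (\int[P]_t (w k t)%:E = (mu k)%:E)%E.
Hypothesis w_var : forall k, (k < N)%N ->
  (\int[P]_t ((w k t - mu k) ^+ 2)%:E = (sigma k ^+ 2)%:E)%E.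
Hypothesis w_supp : forall k, (k < N)%N ->
  rv_support P (w k) = [set` `[mu k - Delta, mu k + Delta]].

Local Notation M := ((Delta + \sum_(k < N) mu k) / N%:R).

Lemma measurable_stage_cost (pi : nat -> R -> R) k :
  is_policy pi -> (k <= N)%N ->
  measurable_fun setT (fun t => G (pi k (state pi w k t))).
Proof.
move=> pi_pol kN.
have ms : measurable_fun setT (state pi w k).
  apply: measurable_state => [i|i ik]; first by case: (pi_pol i).
  by apply: w_indep.1; exact: leq_trans kN.
(* Monotonicity of [G] is known on the nonnegative reals only; truncating the argument at 0 gives a
   function monotone on the whole line, and orders are nonnegative. *)
have mG : measurable_fun setT (fun x : R => G (Num.max 0 x)).
  apply: nondecreasing_measurable => // a b ab /=.
  have : Num.max 0 a <= Num.max 0 b by rewrite ge_max !le_max lexx ab orbT.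
  rewrite le_eqVlt => /orP[/eqP->//|lt_ab]; apply/ltW/G_incr => //.
  by rewrite le_max lexx.
rewrite (_ : (fun _ => _) =
    (fun x : R => G (Num.max 0 x)) \o (pi k \o state pi w k)).
  by apply: measurableT_comp => //; apply: measurableT_comp; case: (pi_pol k).
by apply/funext => t /=; rewrite max_r //; case: (pi_pol k).
Qed.

Lemma demand_bounds_ae : \forall t \ae P, forall k, (k < N)%N ->
  mu k - Delta <= w k t <= mu k + Delta.
Proof.
apply: ae_foralln => k; have [kN|] := ltnP k N; last by move=> _; apply: aeW.
apply: filterS (rv_support_ae P (w k) (w_indep.1 _ kN)) => t + _.
by rewrite w_supp //= in_itv.
Qed.

Lemma heur_policy_is_policy : is_policy (heur_policy mu Delta N).
Proof.
move=> k; split; last by move=> x; rewrite /heur_policy le_max lexx.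
apply: measurable_maxr => //; exact: measurable_funB.
Qed.

Lemma heur_policy_admissible : admissible P w N (heur_policy mu Delta N).
Proof.
move=> k /andP[_ kN]; apply: filterS demand_bounds_ae => t wP.
by apply: heur_state_ge0 wP _ kN => // i iN; rewrite -subr_gt0 mu_gt.
Qed.

Lemma heur_cost_le (L : R) :
  (forall y, 0 < y -> derivable G y 1 /\ derivable (derive1 G) y 1) ->
  (forall y, 0 < y -> derive1 (derive1 G) y <= L) -> 0 < M -> (0 < N)%N ->
  (cost P w N G (heur_policy mu Delta N) <=
   (N%:R * G M + L / 2 * (\sum_(k < N) (heur_u mu Delta N k - M) ^+ 2 +
      \sum_(0 <= k < N.-1) sigma k ^+ 2))%:E)%E.
Proof.
move=> dG G2 M0 N0; set u := heur_u mu Delta N.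
pose s k := if k is k'.+1 then sigma k' ^+ 2 else 0.
(* The constant coefficient when the quadratic bound at [M] is expanded in powers of the noise
   around [u k]; the linear one is G'(M) + L (u_k - M) and integrates to 0. *)
pose a k := G M + derive1 G M * (u k - M) + L / 2 * (u k - M) ^+ 2.
apply: (@le_trans _ _ (\sum_(k < N) (a k + L / 2 * s k)%:E)%E).
  apply: lee_sum => k _; have kN := ltn_ord k.
  have [mZ Z1 Z2] := noise_moments P mu sigma w N k w_indep.1 w_mean w_var kN.
  have [iq <-] := expectation_quadratic P (noise mu w k) (a k)
    (derive1 G M + L * (u k - M)) (L / 2) _ mZ Z1 Z2.
  apply: ge0_le_integral_ae => //.
  - exact: measurable_stage_cost heur_policy_is_policy (ltnW kN).
  - by move=> t; apply: G_ge0; case: (heur_policy_is_policy k).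
  - apply: filterS demand_bounds_ae => t wP.
    have mu_gt' i : (i < N)%N -> Delta < mu i.
      by move=> ?; rewrite -subr_gt0 mu_gt.
    rewrite (heur_order mu Delta N w t Delta_ge0 mu_gt' wP) //.
    have o0 := heur_order_gt0 mu Delta N w t Delta_ge0 mu_gt' wP _ kN.
    apply: le_trans (taylor2_le _ _ _ _ dG G2 M0 o0) _.
    rewrite -/u /a le_eqVlt; apply/orP; left; apply/eqP; field.
    by rewrite pnatr_eq0 -lt0n.
rewrite sumEFin lee_fin !big_split /= sumr_const card_ord -!mulr_sumr.
(* Stage 0 carries no noise, so only the variances of the first [N - 1] demands remain. *)
have -> : \sum_(k < N) s k = \sum_(0 <= k < N.-1) sigma k ^+ 2.
  by case: N N0 => // n _; rewrite big_ord_recl /= add0r big_mkord.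
have -> : \sum_(k < N) (u k - M) = 0.
  rewrite sumrB sumr_const card_ord -(big_mkord xpredT u) heur_u_total //.
  by rewrite big_mkord -[_ / _ *+ _]mulr_natr divfK ?subrr // pnatr_eq0 -lt0n.
by rewrite -[G M *+ N]mulr_natl mulr0 addr0 mulrDr addrA.
Qed.

(** The last order is placed before the last demand is seen, so the stock after it must cover the
    worst case in the support. *)
Lemma last_demand_le_ae (pi : nat -> R -> R) n : N = n.+1 ->
  is_policy pi -> admissible P w N pi ->
  \forall t \ae P, mu n + Delta <= state pi w n t + pi n (state pi w n t).
Proof.
move=> NE pi_pol adm; have nN : (n < N)%N by rewrite NE.
have mpi i : measurable_fun setT (pi i) by case: (pi_pol i).
apply: (@ae_ge_of_independent _ _ _ P (w n)).
- exact: w_indep.1.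
- have ms : measurable_fun setT (state pi w n).
    apply: measurable_state => // i ik; apply: w_indep.1.
    exact: ltn_trans nN.
  by apply: measurable_funD => //; apply: measurableT_comp.
- move=> A B mA mB; apply: cylinders_independent => //; first by rewrite -NE.
  (* The state depends on past demands only: it is measurable for the sigma-algebra generated by the
     cylinders. *)
  have ms : measurable_fun (T := g_sigma_algebraType (cylinders w n)) setT
      (state pi w n).
    apply: (measurable_state (T := g_sigma_algebraType _)) => // i ik.
    move=> _ C mC; rewrite setTI; apply: sub_sigma_algebra.
    exists (fun j => if j == i then C else setT); first by move=> j; case: ifP.
    apply/seteqP; split=> t /=.
      by move=> wC j _ /=; case: eqP => // ->.
    by move=> /(_ i ik) /=; rewrite eqxx.
  rewrite -[_ @^-1` _]setTI.
  apply: (measurable_funD (T := g_sigma_algebraType _) ms _) => //.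
  exact: measurableT_comp (mpi n) ms.
- rewrite w_supp //= in_itv /= lexx andbT lerD2l.
  by rewrite (le_trans _ Delta_ge0) // oppr_le0.
(* Nonnegativity of the final state says that the last demand is at most the level after the last
   order. *)
- have := adm n.+1; rewrite NE leqnn => /(_ isT).
  by apply: filterS => t /=; rewrite subr_ge0.
Qed.

Lemma state_telescope (pi : nat -> R -> R) k t :
  state pi w k t = \sum_(i < k) pi i (state pi w i t) - \sum_(i < k) w i t.
Proof.
elim: k => [|k IH] /=; first by rewrite !big_ord0 subrr.
by rewrite !big_ord_recr /= {1}IH; ring.
Qed.

Lemma cost_ge (pi : nat -> R -> R) :
  (forall x y t, 0 <= x -> 0 <= y -> x != y -> 0 < t < 1 ->
     G (t * x + (1 - t) * y) < t * G x + (1 - t) * G y) ->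
  G 0 = 0 -> derivable G M 1 -> 0 < M -> (0 < N)%N ->
  is_policy pi -> admissible P w N pi ->
  ((N%:R * G M)%:E <= cost P w N G pi)%E.
Proof.
move=> cG G00 dGM M0 N0 pi_pol adm.
have tangent y : 0 <= y -> G M + derive1 G M * (y - M) <= G y.
  by move=> y0; apply: convex_tangent_le => //; exact: ltW.
(* The tangent at [M], evaluated at 0, gives G'(M) M >= G(M) >= 0. The sign is needed to multiply
   the lower bound on the total order by the slope. *)
have slope : 0 <= derive1 G M.
  have := tangent 0 (lexx _); rewrite G00 sub0r mulrN subr_le0 => GM.
  by rewrite -(pmulr_lge0 _ M0) (le_trans _ GM) // G_ge0 // ltW.
pose f (k : 'I_N) t := (G (pi k (state pi w k t)))%:E.
have f0 k t : (0 <= f k t)%E by rewrite lee_fin G_ge0 //; case: (pi_pol k).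
have mG k : (k < N)%N ->
    measurable_fun setT (fun t => G (pi k (state pi w k t))).
  by move=> /ltnW; exact: measurable_stage_cost.
have -> : cost P w N G pi = (\int[P]_t
    (\sum_(k < N) G (pi k (state pi w k t)))%:E)%E.
  under [RHS]eq_integral do rewrite -sumEFin.
  rewrite (@ge0_integral_sum _ _ _ P setT measurableT _ f) // => k.
  exact/measurable_EFinP/mG.
(* A random lower bound for the total cost, with expectation [N%:R * G M]; the zero quadratic term
   fits it to [expectation_quadratic]. *)
pose g t := \sum_(k < N)
  (G M + derive1 G M * noise mu w k t + 0 * noise mu w k t ^+ 2).
have ig (k : 'I_N) : P.-integrable setT (EFin \o (fun t => G M +
      derive1 G M * noise mu w k t + 0 * noise mu w k t ^+ 2)) /\
    (\int[P]_t (G M + derive1 G M * noise mu w k t + 0 * noise mu w k t ^+ 2)%:E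
      = (G M)%:E)%E.
  have [mZ Z1 Z2] := noise_moments P mu sigma w N k w_indep.1
    w_mean w_var (ltn_ord k).
  have [? ->] := expectation_quadratic P (noise mu w k) (G M) (derive1 G M) 0 _
    mZ Z1 Z2.
  by split=> //; rewrite mul0r addr0.
have gE : EFin \o g = (fun t => \sum_(k < N) (G M + derive1 G M * noise mu w k t
    + 0 * noise mu w k t ^+ 2)%:E)%E.
  by apply/funext => t; rewrite /= -sumEFin.
have <- : (\int[P]_t (g t)%:E = (N%:R * G M)%:E)%E.
  rewrite [LHS](_ : _ = \int[P]_t (EFin \o g) t)%E // gE integral_sum //.
    rewrite (eq_bigr (fun=> (G M)%:E)); last by move=> k _; case: (ig k).
    by rewrite sumEFin sumr_const card_ord mulr_natl.
  by move=> k; case: (ig k).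
apply: le_integral_ae_ge0.
- by apply: measurable_sum => k; exact: mG.
- by rewrite gE; apply: integrable_sum => // k _; case: (ig k).
- by move=> t; apply: sumr_ge0 => k _; rewrite -lee_fin f0.
have [n NE] : exists n, N = n.+1 by case: N N0 => // n; exists n.
have := last_demand_le_ae pi n NE pi_pol adm; apply: filterS => t.
(* The level after the last order is the sum of all orders minus the earlier demands, so the orders
   sum to at least N M plus all the noise terms. *)
rewrite {1}state_telescope => Yt.
have le1 : \sum_(k < N) (G M + derive1 G M * (pi k (state pi w k t) - M)) <=
    \sum_(k < N) G (pi k (state pi w k t)).
  by apply: ler_sum => k _; apply: tangent; case: (pi_pol k).
apply: le_trans le1; rewrite /g.
under eq_bigr do rewrite mul0r addr0.
rewrite !big_split /= lerD2l -!mulr_sumr; apply: ler_wpM2l => //.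
rewrite sumrB sumr_const card_ord -[M *+ N]mulr_natr divfK ?pnatr_eq0 -?lt0n //.
move: Yt; rewrite NE big_ord_recl /= add0r.
rewrite [\sum_(i < n) (_ - _)](eq_bigr (fun i : 'I_n => w i t - mu i)) //.
rewrite sumrB !big_ord_recr /=; lra.
Qed.

End Bounds.

Theorem theorem3 (R : realType) (d : measure_display) (T : measurableType d)
  (P : probability T R) (N : nat) (G : R -> R) (L Delta : R)
  (mu sigma : nat -> R) (w : nat -> T -> R) :
  (1 <= N)%N ->
  (* G : R_{>=0} -> R_{>=0}, G(0) = 0 *)
  G 0 = 0 ->
  (forall x, 0 <= x -> 0 <= G x) ->
  (* strictly convex on [0, oo) *)
  (forall x y t, 0 <= x -> 0 <= y -> x != y -> 0 < t < 1 ->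
     G (t * x + (1 - t) * y) < t * G x + (1 - t) * G y) ->
  (* increasing on [0, oo) *)
  (forall x y, 0 <= x -> x < y -> G x < G y) ->
  (* twice differentiable on (0, oo) with G'' <= L *)
  (forall y, 0 < y -> derivable G y 1 /\ derivable (derive1 G) y 1) ->
  (forall y, 0 < y -> derive1 (derive1 G) y <= L) ->
  (* demands *)
  mutually_independent P w N ->
  0 <= Delta ->
  (forall k, (k < N)%N -> 0 < mu k - Delta) ->
  (forall k, (k < N)%N -> (\int[P]_t (w k t)%:E = (mu k)%:E)%E) ->
  (forall k, (k < N)%N ->
     (\int[P]_t ((w k t - mu k) ^+ 2)%:E = (sigma k ^+ 2)%:E)%E) ->
  (forall k, (k < N)%N ->
     rv_support P (w k) = [set` `[mu k - Delta, mu k + Delta]]) ->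
  let u := heur_u mu Delta N in
  let M := (Delta + \sum_(k < N) mu k) / N%:R in
  let S_u := \sum_(k < N) (u k - M) ^+ 2 in
  admissible P w N (heur_policy mu Delta N) /\
  (cost P w N G (heur_policy mu Delta N) - opt_cost P w N G
     <= (L / 2 * (S_u + \sum_(0 <= k < N.-1) sigma k ^+ 2))%:E)%E.
Proof.
move=> N0 G00 G_ge0 cG G_incr dG G2 w_indep Delta_ge0 mu_gt w_mean w_var w_supp.
move=> u M S_u.
have M0 : 0 < M.
  apply: divr_gt0; last by rewrite ltr0n.
  apply: ltr_wpDl => //; case: N N0 mu_gt {w_indep w_mean w_var w_supp u M S_u}.
    by [].
  move=> n _ mu_gt; rewrite big_ord_recl; apply: ltr_wpDr.
    by apply: sumr_ge0 => i _; have := mu_gt _ (ltn_ord (lift ord0 i)); lra.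
  by have := mu_gt _ (ltn_ord (@ord0 n)); lra.
split; first exact: heur_policy_admissible.
have up : (cost P w N G (heur_policy mu Delta N) <= (N%:R * G M +
    L / 2 * (S_u + \sum_(0 <= k < N.-1) sigma k ^+ 2))%:E)%E.
  exact: heur_cost_le.
have lo : ((N%:R * G M)%:E <= opt_cost P w N G)%E.
  apply: le_ereal_inf_tmp => _ [pi [pi_pol adm] <-].
  apply: (cost_ge P N G Delta mu sigma w) => //.
  exact: (dG _ M0).1.
(* The common finite term [N%:R * G M] of the two bounds cancels. *)
apply: le_trans (leeB up lo) _.
by rewrite -EFinB lee_fin addrAC subrr add0r.
Qed.
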